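(* Let $C(x,y)=\sum_{n,k\geq 0} c_{n,k}x^ny^k$, where $c_{n,k}$ is the number of Catalan words of length $n$ with exactly $k$ descents. Then $$C(x,y)=\frac{1-2x+2xy-\sqrt{1-4x+4x^2-4x^2y}}{2xy}.$$
   Context: A Catalan word of length $n\geq 1$ is a word $w_1w_2\ldots w_n$ over the non-negative integers with $w_1=0$ and $0\leq w_i\leq w_{i-1}+1$ for $i=2,\ldots,n$; the empty word is the unique Catalan word of length $0$. A descent of a word $w_1\ldots w_n$ is an index $i\in\{1,\ldots,n-1\}$ with $w_i>w_{i+1}$. Generating functions are formal power series in $x,y$. *)

(* Defs.v *)
From HB Require Import structures.
From mathcomp Require Import all_boot all_order all_algebra.
From mathcomp Require Import boolp classical_sets.

Set Implicit Arguments.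
Unset Strict Implicit.
Unset Printing Implicit Defensive.

Import GRing.Theory.
Local Open Scope ring_scope.

(* Univariate formal power series over R; [fps_coef f n] is the coefficient   *)
(* of the n-th power of the variable. The record keeps the Cauchy product     *)
(* apart from the pointwise product on functions.                             *)
Record fps (R : Type) := FPS { fps_coef : nat -> R }.

HB.instance Definition _ (R : Type) := gen_eqMixin (fps R).
HB.instance Definition _ (R : Type) := gen_choiceMixin (fps R).

Lemma fpsP (R : Type) (f g : fps R) : fps_coef f =1 fps_coef g <-> f = g.
Proof.
split=> [|-> //]; case: f g => [f] [g] /= fg; congr FPS.
exact: functional_extensionality_dep.
Qed.

Definition fps_zero (R : comNzRingType) : fps R := FPS (fun=> 0).
Definition fps_opp (R : comNzRingType) (f : fps R) : fps R :=
  FPS (fun n => - fps_coef f n).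
Definition fps_add (R : comNzRingType) (f g : fps R) : fps R :=
  FPS (fun n => fps_coef f n + fps_coef g n).

Definition fpsC (R : comNzRingType) (a : R) : fps R :=
  FPS (fun n => if n == 0%N then a else 0).
Definition fpsX (R : comNzRingType) : fps R := FPS (fun n => (n == 1%N)%:R).

Definition fps_mul (R : comNzRingType) (f g : fps R) : fps R :=
  FPS (fun n => \sum_(i < n.+1) fps_coef f i * fps_coef g (n - i)%N).

Lemma fps_addA (R : comNzRingType) : associative (@fps_add R).
Proof. by move=> f g h; apply/fpsP => n /=; rewrite addrA. Qed.
Lemma fps_addC (R : comNzRingType) : commutative (@fps_add R).
Proof. by move=> f g; apply/fpsP => n /=; rewrite addrC. Qed.
Lemma fps_add0 (R : comNzRingType) : left_id (fps_zero R) (@fps_add R).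
Proof. by move=> f; apply/fpsP => n /=; rewrite add0r. Qed.
Lemma fps_addN (R : comNzRingType) :
  left_inverse (fps_zero R) (@fps_opp R) (@fps_add R).
Proof. by move=> f; apply/fpsP => n /=; rewrite addNr. Qed.

HB.instance Definition _ (R : comNzRingType) := GRing.isZmodule.Build (fps R)
  (@fps_addA R) (@fps_addC R) (@fps_add0 R) (@fps_addN R).

Lemma fps_mul_trunc (R : comNzRingType) (f g : fps R) (p q : {poly R}) n :
    (forall i, (i <= n)%N -> fps_coef f i = p`_i) ->
    (forall i, (i <= n)%N -> fps_coef g i = q`_i) ->
  forall i, (i <= n)%N -> fps_coef (fps_mul f g) i = (p * q)`_i.
Proof.
move=> fp gq i le_in; rewrite coefM /=; apply: eq_bigr => j _.
rewrite fp ?gq // ?(leq_trans (leq_subr _ _)) //.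
by rewrite (leq_trans _ le_in) // -ltnS.
Qed.

Lemma fps_truncP (R : comNzRingType) (f : fps R) n i : (i <= n)%N ->
  fps_coef f i = (\poly_(j < n.+1) fps_coef f j)`_i.
Proof. by move=> le_in; rewrite coef_poly ltnS le_in. Qed.

Lemma fps_mulA (R : comNzRingType) : associative (@fps_mul R).
Proof.
move=> f g h; apply/fpsP => n.
have [[tf tg] th] := (@fps_truncP R f n, @fps_truncP R g n, @fps_truncP R h n).
rewrite (fps_mul_trunc tf (fps_mul_trunc tg th)) //.
by rewrite (fps_mul_trunc (fps_mul_trunc tf tg) th) // mulrA.
Qed.

Lemma fps_mulC (R : comNzRingType) : commutative (@fps_mul R).
Proof.
move=> f g; apply/fpsP => n; have [tf tg] := (@fps_truncP R f n, @fps_truncP R g n).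
by rewrite (fps_mul_trunc tf tg) // (fps_mul_trunc tg tf) // mulrC.
Qed.

Lemma fps_mul1 (R : comNzRingType) : left_id (fpsC (1 : R)) (@fps_mul R).
Proof.
move=> f; apply/fpsP => n /=; rewrite big_ord_recl /= mul1r subn0 big1 ?addr0 //.
by move=> i _; rewrite mul0r.
Qed.

Lemma fps_mulDl (R : comNzRingType) :
  left_distributive (@fps_mul R) (@fps_add R).
Proof.
move=> f g h; apply/fpsP => n /=; rewrite -big_split /=.
by apply: eq_bigr => i _; rewrite mulrDl.
Qed.

Lemma fps_one_neq0 (R : comNzRingType) : fpsC (1 : R) != 0.
Proof. by apply/eqP => /fpsP/(_ 0%N)/eqP; rewrite /= oner_eq0. Qed.

HB.instance Definition _ (R : comNzRingType) :=
  GRing.Zmodule_isComNzRing.Build (fps R)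
    (@fps_mulA R) (@fps_mulC R) (@fps_mul1 R) (@fps_mulDl R) (@fps_one_neq0 R).

Definition fps_unit (R : idomainType) : pred (fps R) :=
  fun f => `[< exists g, g * f = 1 >].
Definition fps_inv (R : idomainType) (f : fps R) : fps R :=
  xget f (fun g => g * f = 1).

Lemma fps_mulV (R : idomainType) :
  {in @fps_unit R, left_inverse 1 (@fps_inv R) *%R}.
Proof. by move=> f /asboolP[g gf]; apply: (@xgetI _ f (fun g => g * f = 1) g). Qed.

Lemma fps_unitPl (R : idomainType) (f g : fps R) : g * f = 1 -> fps_unit f.
Proof. by move=> gf; apply/asboolP; exists g. Qed.

Lemma fps_inv_out (R : idomainType) :
  {in [predC @fps_unit R], @fps_inv R =1 id}.
Proof.
move=> f /negP nf; apply: xgetPN => g gf; exact/nf/(fps_unitPl gf).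
Qed.

HB.instance Definition _ (R : idomainType) :=
  GRing.ComNzRing_hasMulInverse.Build (fps R)
    (@fps_mulV R) (@fps_unitPl R) (@fps_inv_out R).

Lemma fps_mulf_eq0 (R : idomainType) (f g : fps R) :
  f * g = 0 -> (f == 0) || (g == 0).
Proof.
have ord (h : fps R) : h != 0 ->
    exists2 m, fps_coef h m != 0 & forall i, (i < m)%N -> fps_coef h i = 0.
  move=> h0; have ex : exists m, fps_coef h m != 0.
    apply: contrapT => nex; case/eqP: h0; apply/fpsP => m /=.
    by apply/eqP/negPn/negP => hm; apply: nex; exists m.
  case: (ex_minnP ex) => m hm minm; exists m => // i im.
  by apply/eqP/negPn/negP => /minm; rewrite leqNgt im.
move=> fg0; apply/norP => -[/ord[m fm f0] /ord[k gk g0]].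
have /eqP := (fpsP _ _).2 fg0 (m + k)%N.
rewrite /= (bigD1 (Ordinal (leq_addr k m : (m < (m + k).+1)%N))) //= addKn.
rewrite big1 ?addr0 ?mulf_eq0 ?(negPf fm) ?(negPf gk) // => i.
rewrite -val_eqE /= neq_ltn => /orP[im|mi]; first by rewrite f0 // mul0r.
rewrite g0 ?mulr0 // ltn_subLR ?ltn_add2r //.
by rewrite -ltnS.
Qed.

HB.instance Definition _ (R : idomainType) :=
  GRing.ComUnitRing_isIntegral.Build (fps R) (@fps_mulf_eq0 R).

(* Bivariate series in x, y over the rationals, as series in x whose          *)
(* coefficients are series in y: the coefficient of x^n y^k in F is           *)
(* [fps_coef (fps_coef F n) k].                                               *)
Notation fps2 := (fps (fps rat)).

Definition fps2_x : fps2 := fpsX _.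
Definition fps2_y : fps2 := fpsC (fpsX _).

(* The square root, with constant term 1, of a series with constant term 1;   *)
(* it is unique by [fps2_sqrt_uniq].                                          *)
Definition fps2_is_sqrt (F G : fps2) : Prop :=
  G ^+ 2 = F /\ fps_coef (fps_coef G 0) 0 = 1.
Definition fps2_sqrt (F : fps2) : fps2 := xget 0 (fps2_is_sqrt F).

Lemma fps2_sqrt_uniq (F G H : fps2) :
  fps2_is_sqrt F G -> fps2_is_sqrt F H -> G = H.
Proof.
move=> [GF G1] [HF H1]; have /eqP := etrans GF (esym HF).
rewrite eqf_sqr => /orP[/eqP // | /eqP GH].
by move: G1; rewrite GH /= H1 => /eqP.
Qed.

Lemma fps2_sqrtE (F G : fps2) : fps2_is_sqrt F G -> fps2_sqrt F = G.
Proof.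
move=> FG; apply: (fps2_sqrt_uniq _ FG).
exact: (@xgetI _ 0 (fps2_is_sqrt F) G FG).
Qed.

Definition catalan_word (w : seq nat) : bool :=
  if w is a :: w' then (a == 0%N) && path (fun a b => (b <= a.+1)%N) a w'
  else true.

Definition descents (w : seq nat) : nat :=
  count (fun i => (nth 0 w i.+1 < nth 0 w i)%N) (iota 0 (size w).-1).

(* The letters of a Catalan word of length n are smaller than n               *)
(* ([catalan_word_lt]), so that it can be taken as a tuple over 'I_n.         *)
Definition catalan_count (n k : nat) : nat :=
  #|[pred w : n.-tuple 'I_n | catalan_word (map val w) &&
                              (descents (map val w) == k)]|.

Lemma catalan_word_lt (w : seq nat) : catalan_word w ->
  all (fun a => a < size w)%N w.
Proof.
case: w => //= a w /andP[/eqP-> /=].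
have gen : forall b m, (b < m)%N ->
    path (fun a b => (b <= a.+1)%N) b w -> all (fun c => c < m + size w)%N w.
  elim: w => //= c w IH b m bm /andP[cb cw].
  have cm : (c < m.+1)%N by apply: leq_trans bm.
  by rewrite -addSnnS (leq_trans cm (leq_addr _ _)) (IH c).
by move=> /(gen 0%N 1%N isT).
Qed.

Definition catalan_gf : fps2 :=
  FPS (fun n => FPS (fun k => (catalan_count n k)%:R)).

(* Main.v *)
(** A nonempty Catalan word factors uniquely as [0 (u+1) v] with [u] and [v]
    Catalan words, [v] starting at the second letter 0 of the word; its descents
    are those of [u] and of [v], plus one at the junction when both are nonempty.
    Hence [D = C - 1] satisfies [D = x (1 + 2 D + y D^2)], so that
    [1 - 2 x - 2 x y D] is a square root of [(1 - 2 x)^2 - 4 x^2 y], and its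
    constant term is 1. *)
Require Import Defs.
From mathcomp Require Import all_boot all_order all_algebra.
From mathcomp Require Import ring.
Set Implicit Arguments.
Unset Strict Implicit.
Unset Printing Implicit Defensive.

Import GRing.Theory.
Local Open Scope ring_scope.

(** * Coefficients of power series *)

Lemma fps_coefD (R : comNzRingType) (f g : fps R) n :
  fps_coef (f + g) n = fps_coef f n + fps_coef g n.
Proof. by []. Qed.

Lemma fps_coefM (R : comNzRingType) (f g : fps R) n :
  fps_coef (f * g) n = \sum_(i < n.+1) fps_coef f i * fps_coef g (n - i)%N.
Proof. by []. Qed.

Lemma fps_coef1 (R : comNzRingType) n :
  fps_coef (1 : fps R) n = (n == 0%N)%:R.
Proof. by case: n. Qed.

Lemma fps_coef_sum (R : comNzRingType) (I : Type) (r : seq I) (P : pred I)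
    (F : I -> fps R) n :
  fps_coef (\sum_(i <- r | P i) F i) n = \sum_(i <- r | P i) fps_coef (F i) n.
Proof. exact: (big_morph (fun f : fps R => fps_coef f n)). Qed.

Lemma fps_coefCM (R : comNzRingType) (a : R) (f : fps R) n :
  fps_coef (fpsC a * f) n = a * fps_coef f n.
Proof.
rewrite fps_coefM big_ord_recl /= subn0 big1 ?addr0 // => i _.
by rewrite mul0r.
Qed.

Lemma fps_coefXM0 (R : comNzRingType) (f : fps R) : fps_coef (fpsX R * f) 0 = 0.
Proof. by rewrite fps_coefM big_ord1 mul0r. Qed.

Lemma fps_coefXMS (R : comNzRingType) (f : fps R) n :
  fps_coef (fpsX R * f) n.+1 = fps_coef f n.
Proof.
rewrite fps_coefM big_ord_recl mul0r add0r big_ord_recl /= subn1 /= mul1r.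
by rewrite big1 ?addr0 // => i _; rewrite mul0r.
Qed.

Lemma fps_coefXn (R : comNzRingType) m n :
  fps_coef (fpsX R ^+ m) n = (n == m)%:R.
Proof.
elim: m n => [|m IHm] [|n]; rewrite ?expr0 ?fps_coef1 // exprS.
  by rewrite fps_coefXM0.
by rewrite fps_coefXMS IHm eqSS.
Qed.

(** * Descents under concatenation and shift *)

Lemma descents_cons a b s :
  descents [:: a, b & s] = ((b < a) + descents (b :: s))%N.
Proof. by rewrite /descents /= -[1%N]/(1 + 0)%N iotaDl count_map. Qed.

Lemma descents_cat a u b v :
  descents (a :: u ++ b :: v) =
  (descents (a :: u) + (b < last a u) + descents (b :: v))%N.
Proof.
elim: u a => [|c u IHu] a /=; first by rewrite descents_cons.
by rewrite !descents_cons IHu !addnA.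
Qed.

Lemma descents_mapS u : descents (map S u) = descents u.
Proof.
elim: u => [|a [|b u] IHu] //.
by rewrite descents_cons [map _ _]/= descents_cons -[_ :: map _ _]/(map S (b :: u)) IHu.
Qed.

(** * Decomposition at the second letter 0 *)

Definition catalan_glue (p : seq nat * seq nat) : seq nat :=
  0%N :: map S p.1 ++ p.2.

(** If [t] has no 0, [index] is the size of [t] and the second factor is empty. The letters before
    the index are positive, so [predn] lowers each by exactly one. *)
Definition catalan_cut (w : seq nat) : seq nat * seq nat :=
  let t := behead w in
  (map predn (take (index 0%N t) t), drop (index 0%N t) t).

(** The letter [a.+1] following 0 is at most 1 only for [a = 0]; the later bounds are invariant
    under the shift. *)
Lemma catalan_path_mapS u :
  path (fun a b => b <= a.+1)%N 0%N (map S u) = catalan_word u.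
Proof. by case: u => //= a u; rewrite ltnS leqn0 path_map. Qed.

Lemma catalan_word_glue u v : catalan_word u -> catalan_word v ->
  catalan_word (catalan_glue (u, v)).
Proof.
rewrite -catalan_path_mapS /= cat_path => -> /=.
by case: v => //= a v /andP[/eqP-> ->].
Qed.

Lemma catalan_glueK u v : catalan_word v ->
  catalan_cut (catalan_glue (u, v)) = (u, v).
Proof.
move=> vC; rewrite /catalan_cut /=.
(* Shifted letters are nonzero, and [v] is empty or begins with 0. *)
have -> : index 0%N (map S u ++ v) = size (map S u).
  rewrite index_cat ifN; last by apply/mapP => -[].
  by case: v vC => [|a v /andP[/eqP->]] /=; rewrite addn0.
by rewrite take_size_cat // drop_size_cat // mapK.
Qed.

Lemma catalan_cutK w : catalan_word w -> w != [::] ->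
  [/\ catalan_glue (catalan_cut w) = w, catalan_word (catalan_cut w).1
    & catalan_word (catalan_cut w).2].
Proof.
case: w => // a t /= /andP[/eqP->] + _.
set i := index 0%N t; rewrite -{1}(cat_take_drop i t) cat_path => /andP[pu pv].
have uE : map S (map predn (take i t)) = take i t.
  rewrite -map_comp -[RHS]map_id; apply/eq_in_map => -[|b] //= t0.
  by have := index_ltn t0; rewrite ltnn.
split; first by rewrite /catalan_glue /= uE cat_take_drop.
  by rewrite -catalan_path_mapS uE.
have [t0|t0] := boolP (0%N \in t); last first.
  by rewrite drop_oversize // leqNgt /i index_mem.
have it : (i < size t)%N by rewrite /i index_mem.
by move: pv; rewrite (drop_nth 0%N it) nth_index //= => /andP[_ ->].
Qed.

(** The leading 0 creates no descent before the shifted [u]. At the junction the left letter is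
    positive unless [u] is empty, and a nonempty [v] begins with 0. *)
Lemma descents_glue u v : catalan_word v ->
  descents (catalan_glue (u, v)) =
  (descents u + ((u != [::]) && (v != [::])) + descents v)%N.
Proof.
have du : descents (0%N :: map S u) = descents u.
  by case: u => // a u; rewrite [map _ _]/= descents_cons -/(map S (a :: u)) descents_mapS.
case: v => [|a v]; first by rewrite /catalan_glue cats0 du andbF !addn0.
case/andP => /eqP-> _; rewrite descents_cat du andbT; congr (_ + _ + _)%N.
by case/lastP: u {du} => // u b; rewrite map_rcons last_rcons; case: u.
Qed.

(** * Enumeration of Catalan words by length *)

Definition catalan_words (n : nat) : seq (seq nat) :=
  [seq w <- [seq map val (tval w) | w : n.-tuple 'I_n] | catalan_word w].

Lemma catalan_words_uniq n : uniq (catalan_words n).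
Proof.
apply/filter_uniq; rewrite map_inj_uniq ?enum_uniq //.
by move=> u v /(inj_map val_inj)/val_inj.
Qed.

Lemma mem_catalan_words n w :
  (w \in catalan_words n) = catalan_word w && (size w == n).
Proof.
rewrite mem_filter; case: (boolP (catalan_word w)) => //= wC.
apply/imageP/eqP => [[t _ ->]|wn]; first by rewrite size_map size_tuple.
case: n / wn; have wlt := catalan_word_lt wC.
(* [inord] needs a nonempty ordinal type, so the empty word is treated apart. *)
case: w wC wlt => [|a w] wC wlt; first by exists [tuple].
exists (map_tuple inord (in_tuple (a :: w))) => //=.
rewrite -map_comp -[LHS]map_id -[RHS]/(map _ (a :: w)).
by apply/eq_in_map => b /(allP wlt) blt /=; rewrite inordK.
Qed.

Lemma catalan_words0 : catalan_words 0 = [:: [::]].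
Proof.
apply: perm_small_eq => //; apply: uniq_perm; rewrite ?catalan_words_uniq //.
by move=> [|a w]; rewrite mem_catalan_words // andbF.
Qed.

(** Gluing is inverted by [catalan_cut]; the leading 0 uses one letter, which leaves total length
    [n] for the two factors. *)
Lemma catalan_wordsS n :
  perm_eq (catalan_words n.+1)
    [seq catalan_glue p | i <- iota 0 n.+1,
       p <- [seq (u, v) | u <- catalan_words i, v <- catalan_words (n - i)]].
Proof.
apply: uniq_perm; first exact: catalan_words_uniq.
  apply: (@allpairs_uniq_dep _ _ _ (fun _ p => catalan_glue p));
    first exact: iota_uniq.
    move=> i _; apply: allpairs_uniq; try exact: catalan_words_uniq.
    by move=> [u v] [u' v'].
  move=> a b /allpairsPdep[i [p [_ /allpairsP[[u v] [uw vw ->]] ->]]].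
  move=> /allpairsPdep[j [q [_ /allpairsP[[u' v'] [u'w v'w ->]] ->]]] /=.
  move: uw vw u'w v'w; rewrite !mem_catalan_words /=.
  move=> /andP[_ /eqP ui] /andP[vC _] /andP[_ /eqP u'i] /andP[v'C _].
  (* Cutting recovers [u] and [v], and the size of [u] recovers [i]. *)
  move/(congr1 catalan_cut); rewrite !catalan_glueK // => -[uu' vv'].
  by move: ui u'i; rewrite uu' vv' => -> ->.
move=> w; rewrite mem_catalan_words; apply/andP/allpairsPdep => [[wC /eqP wn]|].
  have w0 : w != [::] by case: w wn {wC}.
  have [wE uC vC] := catalan_cutK wC w0.
  have sz : (size (catalan_cut w).1 + size (catalan_cut w).2 = n)%N.
    by move: wn; rewrite -{1}wE /= size_cat size_map => -[].
  exists (size (catalan_cut w).1), (catalan_cut w); split=> //.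
    by rewrite mem_iota ltnS -sz leq_addr.
  apply/allpairsP; exists (catalan_cut w).
  by rewrite !mem_catalan_words uC vC eqxx -sz addKn eqxx.
case=> i [p [+ /allpairsP[[u v] [+ + ->]] ->]].
rewrite mem_iota !mem_catalan_words /= ltnS => ni /andP[uC /eqP ui] /andP[vC /eqP vi].
split; first exact: catalan_word_glue.
by rewrite size_cat size_map ui vi subnKC.
Qed.

(** * The functional equation and its solution *)

Definition catalan_poly (n : nat) : fps rat :=
  \sum_(w <- catalan_words n) fpsX rat ^+ descents w.

Lemma catalan_gf_coef n : fps_coef catalan_gf n = catalan_poly n.
Proof.
apply/fpsP => k; rewrite fps_coef_sum big_filter big_image_cond /=.
under eq_bigr do rewrite fps_coefXn.
rewrite -natr_sum -big_mkcondr /= sum1_card; congr (_%:R); apply: eq_card => w.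
by rewrite !inE eq_sym.
Qed.

Lemma catalan_poly0 : catalan_poly 0 = 1.
Proof. by rewrite /catalan_poly catalan_words0 big_seq1. Qed.

(** The Boolean exponent of y is the descent at the junction, present when both factors are
    nonempty. *)
Lemma catalan_polyS n :
  catalan_poly n.+1 = \sum_(i < n.+1) fpsX rat ^+ ((i != 0%N :> nat) && (n - i != 0)%N)
                        * (catalan_poly i * catalan_poly (n - i)).
Proof.
rewrite {1}/catalan_poly (perm_big _ (catalan_wordsS n)) big_allpairs_dep.
rewrite -[iota 0 n.+1]/(index_iota 0 n.+1) big_mkord; apply: eq_bigr => i _.
rewrite big_allpairs_dep /= mulr_suml mulr_sumr big_seq [RHS]big_seq.
apply: eq_bigr => u; rewrite mem_catalan_words => /andP[_ /eqP <-].
rewrite mulr_sumr mulr_sumr big_seq [RHS]big_seq.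
apply: eq_bigr => v; rewrite mem_catalan_words => /andP[vC /eqP <-].
by rewrite descents_glue // !size_eq0 !exprD; ring.
Qed.

Lemma catalan_gf_eq (D := catalan_gf - 1) :
  D = fps2_x * (1 + D + D + fps2_y * D ^+ 2).
Proof.
have dE i : fps_coef D i = catalan_poly i - (i == 0%N)%:R.
  by rewrite -catalan_gf_coef -fps_coef1.
apply/fpsP => -[|n]; first by rewrite fps_coefXM0 dE catalan_poly0 subrr.
rewrite fps_coefXMS dE subr0 catalan_polyS.
(* The four products match the cases of each factor being empty or not; only two nonempty factors
   carry y. *)
have -> : 1 + D + D + fps2_y * D ^+ 2 = 1 * 1 + D * 1 + 1 * D + fps2_y * (D * D).
  by ring.
rewrite !fps_coefD [fps_coef (fps2_y * _) n]fps_coefCM !fps_coefM mulr_sumr.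
rewrite -!big_split.
apply: eq_bigr => i _; rewrite !fps_coef1 !dE.
(* As [D] has no constant term in x, at most one of the four products survives in each case. *)
case: eqP => [->|_]; case: eqP => [->|_];
  by rewrite ?catalan_poly0 ?expr0 ?expr1 /=; ring.
Qed.

(* The identity is read in the fraction field of Q[[x, y]]. *)
Theorem theorem1 :
  let x := fps2_x in
  let y := fps2_y in
  FracField.tofrac catalan_gf =
  FracField.tofrac (1 - 2 * x + 2 * x * y
                    - fps2_sqrt (1 - 4 * x + 4 * x ^+ 2 - 4 * x ^+ 2 * y))
    / FracField.tofrac (2 * x * y) :> {fraction fps2}.
Proof.
move=> x y; set D := catalan_gf - 1.
have DE : D = x * (1 + D + D + y * D ^+ 2) := catalan_gf_eq.
have -> : fps2_sqrt (1 - 4 * x + 4 * x ^+ 2 - 4 * x ^+ 2 * y) =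
          1 - 2 * x - 2 * x * y * D.
  apply: fps2_sqrtE; split.
    (* The square differs from the radicand by [- 4 * x * y] times the defect of the functional
       equation, which is 0. *)
    transitivity (1 - 4 * x + 4 * x ^+ 2 - 4 * x ^+ 2 * y
      - 4 * x * y * (D - x * (1 + D + D + y * D ^+ 2))); first by ring.
    by rewrite -DE subrr mulr0 subr0.
  (* Factoring out [x] exhibits the constant term 1, which selects the branch of the root. *)
  have -> : 1 - 2 * x - 2 * x * y * D = 1 + x * (- (2 + 2 * y * D)) by ring.
  by rewrite !fps_coefD fps_coefXM0 addr0.
have -> : 1 - 2 * x + 2 * x * y - (1 - 2 * x - 2 * x * y * D) =
          catalan_gf * (2 * x * y) by rewrite /D; ring.
(* Cancelling [2 * x * y] in the fraction field requires each factor to be nonzero. *)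
have x0 : x != 0.
  by apply/eqP => /fpsP/(_ 1%N)/eqP; rewrite oner_eq0.
have y0 : y != 0.
  by apply/eqP => /fpsP/(_ 0%N)/fpsP/(_ 1%N)/eqP; rewrite oner_eq0.
have two0 : 2 != 0 :> fps2.
  by apply/eqP => /fpsP/(_ 0%N)/fpsP/(_ 0%N)/eqP.
by rewrite tofracM mulfK // tofrac_eq0 !mulf_neq0.
Qed.
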